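(* Let $n>2$ and $1<p<\frac{n}{n-1}$. Let $X=(X_1,\dots,X_m)$ be real $C^\infty$ vector fields on $\mathbb{R}^n$, $X_k=\sum_{i=1}^n a_{k,i}\frac{\partial}{\partial x_i}$, such that the functions $a_{k,i}$ and $\frac{\partial a_{k,j}}{\partial x_i}$ are bounded for every $1\le k\le m$ and $1\le i,j\le n$. Let $u_0\in L^1_{\mathrm{loc}}(\mathbb{R}^n)$, and assume that for $0\le f\in L^1_{\mathrm{loc}}(\mathbb{R}^n)$ there exist $\epsilon>0$ and $\lambda\in\left(0,\frac{p}{p-1}\right)$ such that $f(x)\ge\epsilon\|x\|^{-\lambda}$ whenever $\|x\|\ge1$. Let $T_\epsilon$ denote a time such that a weak solution of $u_t-\Delta_X u=|u|^p+f(x)$, $u(0,x)=u_0(x)$, exists in $[0,T_\epsilon)$. Then there exists a positive constant $C$, not depending on the choice of such $T_\epsilon$, such that $T_\epsilon\le C\,\epsilon^{2/\left(\lambda-\frac{p}{p-1}\right)}$.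
   Context: $\|\cdot\|$ is the Euclidean norm on $\mathbb{R}^n$. For $X_k=\sum_{i=1}^n a_{k,i}\frac{\partial}{\partial x_i}$ put $\operatorname{div}X_k=\sum_{i}\frac{\partial a_{k,i}}{\partial x_i}$, $X_k^\ast=-X_k-\operatorname{div}X_k$ and $\Delta_X=-\sum_{k=1}^m X_k^\ast X_k=\sum_{k=1}^m\bigl(X_k^2+(\operatorname{div}X_k)X_k\bigr)$. Weak solution: for $f,u_0\in L^1_{\mathrm{loc}}(\mathbb{R}^n)$, a function $u\in L^p_{\mathrm{loc}}((0,T),L^p_{\mathrm{loc}}(\mathbb{R}^n))$ is a (local in time) weak solution on $[0,T)$ of $u_t-\Delta_X u=|u|^p+f(x)$, $u(0,x)=u_0(x)$, if for every non-negative test function $\psi\in C^1_c([0,T);C^2_c(\mathbb{R}^n))$ one has $\int_0^T\!\int_{\mathbb{R}^n}|u|^p\psi+\int_{\mathbb{R}^n}u_0\psi(0,x)+\int_0^T\!\int_{\mathbb{R}^n}f\psi+\int_0^T\!\int_{\mathbb{R}^n}u\psi_t+\int_0^T\!\int_{\mathbb{R}^n}u\,\Delta_X\psi=0$. *)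

(* Defs.v *)
From HB Require Import structures.
From mathcomp Require Import all_boot all_order all_algebra.
From mathcomp Require Import all_classical all_reals all_analysis.

Set Implicit Arguments.
Unset Strict Implicit.
Unset Printing Implicit Defensive.

Import Order.TTheory GRing.Theory Num.Theory.
Import numFieldNormedType.Exports.

Local Open Scope classical_set_scope.
Local Open Scope ring_scope.

(* The sigma-algebra on R^n generated by the coordinates; it is the Borel
   sigma-algebra of R^n. *)

Definition rV_coord (R : realType) n (i : 'I_n) (x : 'rV[R]_n) :
  measurableTypeR R := x ord0 i.

Definition rV_display : measure_display -> measure_display.
Proof. exact. Qed.

Section rV_measurable.
Variables (R : realType) (n : nat).

Let rV_set0 : g_sigma_preimage (@rV_coord R n) set0.
Proof. exact: sigma_algebra0. Qed.

Let rV_setC A :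
  g_sigma_preimage (@rV_coord R n) A -> g_sigma_preimage (@rV_coord R n) (~` A).
Proof. exact: sigma_algebraC. Qed.

Let rV_bigcup (F : (set 'rV[R]_n)^nat) :
  (forall i, g_sigma_preimage (@rV_coord R n) (F i)) ->
  g_sigma_preimage (@rV_coord R n) (\bigcup_i F i).
Proof. exact: sigma_algebra_bigcup. Qed.

HB.instance Definition _ := @isMeasurable.Build
  (rV_display default_measure_display) 'rV[R]_n
  (g_sigma_preimage (@rV_coord R n)) rV_set0 rV_setC rV_bigcup.

Lemma measurable_rV_coord (i : 'I_n) :
  measurable_fun [set: 'rV[R]_n] (@rV_coord R n i).
Proof.
move=> _ Y mY; rewrite setTI; apply: sub_sigma_algebra => /=.
rewrite -bigcup_seq/=; exists i => /=; first by rewrite mem_index_enum.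
by exists Y => //; rewrite setTI.
Qed.

Lemma measurable_fun_rV_coordP d (T : measurableType d) (f : T -> 'rV[R]_n) :
  measurable_fun [set: T] f <->
  forall i, measurable_fun [set: T] (@rV_coord R n i \o f).
Proof.
split=> [mf i|mf].
  exact: measurableT_comp (@measurable_rV_coord i) mf.
apply: (@measurability _ _ _ _ [set: T] f _ erefl).
move=> _ [B + <-].
rewrite -bigcup_seq => -[i /= _ [A mA <-]].
by rewrite !setTI -comp_preimage -[X in measurable X]setTI; exact: mf.
Qed.

End rV_measurable.

(* Lebesgue measure on R^n, by recursion on n: the image of the product of the
   Lebesgue measures on R and R^(n-1) under (s, y) |-> (s, y_1, ..., y_(n-1)). *)

Section lebesgue_rV.
Variable R : realType.

Definition rV_cons n (z : measurableTypeR R * 'rV[R]_n) : 'rV[R]_n.+1 :=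
  row_mx (z.1 : R)%:M z.2.

Lemma measurable_rV_cons n : measurable_fun setT (@rV_cons n).
Proof.
apply/measurable_fun_rV_coordP => i.
have [j|j] := @split_ordP 1 n i => ij; subst i.
  rewrite (_ : _ \o _ = fst); first exact: measurable_fst.
  apply/funext => z; rewrite /comp /rV_coord /rV_cons.
  by rewrite (row_mxEl (z.1 : R)%:M) mxE (ord1 j) mulr1n.
rewrite (_ : _ \o _ = @rV_coord R n j \o snd).
  exact: measurableT_comp (@measurable_rV_coord R n j) measurable_snd.
apply/funext => z; rewrite /comp /rV_coord /rV_cons.
by rewrite (row_mxEr (z.1 : R)%:M).
Qed.

Definition rV_uncons n (x : 'rV[R]_n.+1) : measurableTypeR R * 'rV[R]_n :=
  (rV_coord ord0 x, rsubmx (x : 'rV_(1 + n))).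

Lemma measurable_rV_uncons n : measurable_fun setT (@rV_uncons n).
Proof.
apply: measurable_fun_pair => /=; first exact: measurable_rV_coord.
apply/measurable_fun_rV_coordP => i.
rewrite (_ : _ \o _ = @rV_coord R n.+1 (rshift 1 i)).
  exact: measurable_rV_coord.
by apply/funext => x /=; rewrite /rV_coord mxE.
Qed.

Lemma rV_consK n : cancel (@rV_cons n) (@rV_uncons n).
Proof.
move=> [s y]; rewrite /rV_uncons /rV_cons row_mxKr /rV_coord/=; congr pair.
rewrite (_ : ord0 = lshift n (ord0 : 'I_1)); last exact: val_inj.
by rewrite (row_mxEl (s : R)%:M) mxE mulr1n.
Qed.

Section step.
Variables (n : nat) (mu : {sigma_finite_measure set 'rV[R]_n -> \bar R}).

Definition lebesgue_rV_step : set 'rV[R]_n.+1 -> \bar R :=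
  pushforward (@lebesgue_measure R \x mu)%E (@rV_cons n).

Let step0 : lebesgue_rV_step set0 = 0%E.
Proof. by rewrite /lebesgue_rV_step /pushforward preimage_set0 measure0. Qed.

Let step_ge0 A : (0 <= lebesgue_rV_step A)%E.
Proof. by rewrite /lebesgue_rV_step /pushforward measure_ge0. Qed.

Let step_sigma_additive : semi_sigma_additive lebesgue_rV_step.
Proof.
move=> F mF tF mUF; rewrite /lebesgue_rV_step /pushforward preimage_bigcup.
apply: measure_semi_sigma_additive.
- by move=> k; rewrite -[X in measurable X]setTI; exact: measurable_rV_cons.
- apply/trivIsetP => /= i j _ _ ij; rewrite -preimage_setI.
  by move/trivIsetP : tF => /(_ _ _ _ _ ij) ->//; rewrite preimage_set0.
- by rewrite -preimage_bigcup -[X in measurable X]setTI;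
    exact: measurable_rV_cons.
Qed.

HB.instance Definition _ := isMeasure.Build _ _ _ lebesgue_rV_step
  step0 step_ge0 step_sigma_additive.

Let step_sigma_finite : sigma_finite setT lebesgue_rV_step.
Proof.
have /sigma_finiteP[F [TF ndF Foo]] := sigma_finiteT (@lebesgue_measure R).
have /sigma_finiteP[G [TG ndG Goo]] := sigma_finiteT mu.
exists (fun k => @rV_uncons n @^-1` (F k `*` G k)).
  rewrite -preimage_bigcup -(preimage_setT (@rV_uncons n)); congr (_ @^-1` _).
  rewrite -setXTT TF TG predeqE => -[x y]; split.
    move=> [/= [i _ Fix] [j _ Gjy]]; exists (maxn i j) => //; split.
    - by move: x Fix; exact/subsetPset/ndF/leq_maxl.
    - by move: y Gjy; exact/subsetPset/ndG/leq_maxr.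
  by move=> [k _ []/= ? ?]; split; exists k.
move=> k; have [mF Fk] := Foo k; have [mG Gk] := Goo k; split.
  by rewrite -[X in measurable X]setTI; apply: measurable_rV_uncons => //;
    exact: measurableX.
rewrite /lebesgue_rV_step /pushforward -comp_preimage.
rewrite (_ : _ \o _ = id); last by apply/funext => z; exact: rV_consK.
by rewrite preimage_id product_measure1E// lte_mul_pinfty// ge0_fin_numE.
Qed.

HB.instance Definition _ := @Measure_isSigmaFinite.Build _ _ _
  lebesgue_rV_step step_sigma_finite.

End step.

Fixpoint lebesgue_rV n : {sigma_finite_measure set 'rV[R]_n -> \bar R} :=
  match n with
  | 0 => \d_(0 : 'rV[R]_0)
  | n'.+1 => lebesgue_rV_step (lebesgue_rV n')
  end.

End lebesgue_rV.

Section calculus.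
Variables (R : realType) (n : nat).
Implicit Types (g : 'rV[R]_n -> R) (b : 'I_n -> 'rV[R]_n -> R).

(* ['rV[R]_n] carries the sup norm in the library. *)
Definition enorm (x : 'rV[R]_n) : R := Num.sqrt (\sum_(i < n) x ord0 i ^+ 2).

Definition partial (i : 'I_n) g : 'rV[R]_n -> R :=
  fun x => 'D_(delta_mx ord0 i) g x.

Definition partials (s : seq 'I_n) g : 'rV[R]_n -> R := foldr partial g s.

(* All the partial derivatives of order at most k exist and are continuous. *)
Definition Ck (k : nat) g : Prop := forall s : seq 'I_n,
  ((size s < k)%N ->
    forall i x, derivable (partials s g) x (delta_mx ord0 i)) /\
  ((size s <= k)%N -> continuous (partials s g)).

Definition smooth g : Prop := forall k, Ck k g.

(* b stands for the vector field \sum_i b_i d/dx_i. *)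
Definition vfield b g : 'rV[R]_n -> R :=
  fun x => \sum_(i < n) b i x * partial i g x.

Definition divergence b : 'rV[R]_n -> R := fun x => \sum_(i < n) partial i (b i) x.

Definition vfield_adj b g : 'rV[R]_n -> R :=
  fun x => - vfield b g x - divergence b x * g x.

Definition laplacianX m (a : 'I_m -> 'I_n -> 'rV[R]_n -> R) g : 'rV[R]_n -> R :=
  fun x => - \sum_(k < m) vfield_adj (a k) (vfield (a k) g) x.

End calculus.

Section weak_solution.
Variables (R : realType) (n : nat).
Local Notation leb1 := (@lebesgue_measure R).
Local Notation leb := (lebesgue_rV R n).

Definition L1loc (g : 'rV[R]_n -> R) : Prop :=
  measurable_fun [set: 'rV[R]_n] g /\
  forall K : set 'rV[R]_n, compact K ->
    (\int[leb]_(x in K) `|g x|%:E < +oo)%E.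

(* L^p_loc((0,T), L^p_loc(R^n)). *)
Definition Lploc (p T : R) (u : R -> 'rV[R]_n -> R) : Prop :=
  measurable_fun (`]0, T[ `*` [set: 'rV[R]_n])
    (fun z : measurableTypeR R * 'rV[R]_n => u z.1 z.2) /\
  forall (J : set R) (K : set 'rV[R]_n),
    compact J -> J `<=` `]0, T[ -> compact K ->
    (\int[leb1]_(t in J) \int[leb]_(x in K) (`|u t x| `^ p)%:E < +oo)%E.

(* The distance of g and h in the C^2 norm is at most e. *)
Definition C2_close (e : R) (g h : 'rV[R]_n -> R) : Prop :=
  forall s : seq 'I_n, (size s <= 2)%N ->
  forall x, `|partials s g x - partials s h x| <= e.

(* psi is in C^1_c([0,T); C^2_c(R^n)): a compactly supported C^1 curve in
   C^2_c(R^n) takes its values in C^2_K(R^n) for some compact K, so that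
   continuity and differentiability in t (one-sided at 0) are with respect to
   the C^2 norm. The values of psi outside [0,T) are irrelevant. *)
Definition test_function (T : R) (psi : R -> 'rV[R]_n -> R) : Prop :=
  (exists (tau : R) (K : set 'rV[R]_n), [/\ tau < T, compact K &
     forall t x, 0 <= t < T -> psi t x != 0 -> t <= tau /\ K x]) /\
  (forall t, 0 <= t < T -> Ck 2 (psi t)) /\
  exists dpsi : R -> 'rV[R]_n -> R,
    [/\ forall t, 0 <= t < T -> Ck 2 (dpsi t),
        forall t e, 0 <= t < T -> 0 < e -> exists2 d, 0 < d &
          forall s, 0 <= s < T -> s != t -> `|s - t| < d ->
          C2_close e (fun x => (psi s x - psi t x) / (s - t)) (dpsi t) &
        forall t e, 0 <= t < T -> 0 < e -> exists2 d, 0 < d &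
          forall s, 0 <= s < T -> `|s - t| < d ->
          C2_close e (dpsi s) (dpsi t)].

(* The identity is in the extended real numbers: as its right-hand side is 0,
   it asserts in particular that the five terms are finite. *)
Definition weak_solution m (a : 'I_m -> 'I_n -> 'rV[R]_n -> R) (p : R)
    (f u0 : 'rV[R]_n -> R) (T : R) (u : R -> 'rV[R]_n -> R) : Prop :=
  Lploc p T u /\
  forall psi : R -> 'rV[R]_n -> R, test_function T psi ->
  (forall t x, 0 <= t < T -> 0 <= psi t x) ->
  (\int[leb1]_(t in `]0%R, T[) \int[leb]_x (`|u t x| `^ p * psi t x)%:E +
   \int[leb]_x (u0 x * psi 0 x)%:E +
   \int[leb1]_(t in `]0%R, T[) \int[leb]_x (f x * psi t x)%:E +
   \int[leb1]_(t in `]0%R, T[) \int[leb]_x (u t x * derive1 (psi ^~ x) t)%:E +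
   \int[leb1]_(t in `]0%R, T[) \int[leb]_x (u t x * laplacianX a (psi t) x)%:E
   = 0)%E.

End weak_solution.

(* Main.v *)
(* The proof tests the equation with psi(t,x) = eta(t) Phi(x), where eta is
   supported in [0, T/2], Phi is supported in the ball of radius T, and both are
   the k-th power of the positive part of a quadratic polynomial.  Since
   eta(0) = 0, the initial datum drops out.  Because the coefficients of X are
   bounded together with their first derivatives, psi_t and Delta_X psi are both
   O(psi^((k-2)/k) / T); once k - 2 >= 2/(p-1), Young's inequality absorbs the
   two terms containing u into the integral of |u|^p psi, at the cost of
   O(T^(n+1-p')) with p' = p/(p-1).  The source term is at least
   c eps T^(n+1-lam), hence eps <= C T^(lam-p') <= C T^((lam-p')/2) for T >= 4n,
   while for T <= 4n the bound follows from eps <= eps0. *)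

Require Import Defs.
From HB Require Import structures.
From mathcomp Require Import all_boot all_order all_algebra.
From mathcomp Require Import all_classical all_reals all_analysis.
From mathcomp Require Import measurable_realfun.
From mathcomp Require Import ring lra.

Import Order.TTheory GRing.Theory Num.Theory.
Import numFieldNormedType.Exports.

Local Open Scope classical_set_scope.
Local Open Scope ring_scope.

Set Implicit Arguments.
Unset Strict Implicit.
Unset Printing Implicit Defensive.

(** * Monotonicity of integrals *)

(* No measurability is required: a nonnegative integral is a supremum over
   simple functions below. *)
Lemma ge0_le_integral_sup d (T : measurableType d) (R : realType)
    (mu : {measure set T -> \bar R}) (D : set T) (f g : T -> \bar R) :
  (forall x, D x -> (0 <= f x)%E) -> (forall x, D x -> (f x <= g x)%E) ->
  (\int[mu]_(x in D) f x <= \int[mu]_(x in D) g x)%E.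
Proof.
move=> f0 fg; have g0 x : D x -> (0 <= g x)%E.
  by move=> Dx; rewrite (le_trans (f0 x Dx))// fg.
rewrite !ge0_integralE//; apply: ub_ereal_sup => _ [h /= hf <-].
apply: ereal_sup_ubound; exists h => //= x.
rewrite (le_trans (hf x))// !patchE; case: ifPn => // /set_mem Dx.
exact: fg.
Qed.

(** The integrals of [f^\+] and [f^\-] both lie between 0 and the integral of [g], which therefore
    bounds the modulus of their difference. *)
Lemma le_integral_abs d (T : measurableType d) (R : realType)
    (mu : {measure set T -> \bar R}) (D : set T) (f g : T -> \bar R) :
  (forall x, D x -> (`|f x| <= g x)%E) ->
  (`|\int[mu]_(x in D) f x| <= \int[mu]_(x in D) g x)%E.
Proof.
move=> fg.
have pos : (\int[mu]_(x in D) f^\+ x <= \int[mu]_(x in D) g x)%E.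
  apply: ge0_le_integral_sup => // x Dx; rewrite (le_trans _ (fg x Dx))//.
  by rewrite funeposE ge_max lee_abs abse_ge0.
have neg : (\int[mu]_(x in D) f^\- x <= \int[mu]_(x in D) g x)%E.
  apply: ge0_le_integral_sup => // x Dx; rewrite (le_trans _ (fg x Dx))//.
  by rewrite funenegE ge_max -abseN lee_abs abse_ge0.
have pos0 : (0 <= \int[mu]_(x in D) f^\+ x)%E by exact: integral_ge0.
have neg0 : (0 <= \int[mu]_(x in D) f^\- x)%E by exact: integral_ge0.
rewrite integralE.
move: (integral _ _ _) (integral _ _ _) (integral _ _ _) pos neg pos0 neg0.
move=> [a| |] [b| |] [c| |]//=; rewrite ?lee_fin ?leey//.
  by move=> ac bc a0 b0; rewrite ler_norml; lra.
Qed.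

Lemma lebesgue_measure_itvcc (R : realType) (c d : R) : c <= d ->
  lebesgue_measure `[c, d] = (d - c)%:E.
Proof.
move=> cd; rewrite lebesgue_measure_itv/= lte_fin.
by case: ltgtP cd => // -> _; rewrite subrr.
Qed.

(** * Lebesgue measure of cubes *)

Section box.
Variables (R : realType).

Definition box (n : nat) (c d : R) : set 'rV[R]_n :=
  [set x | forall i, c <= x ord0 i <= d].

Lemma measurable_box n c d : measurable (@box n c d).
Proof.
rewrite (_ : box c d = \bigcap_(i in [set: 'I_n]) (@rV_coord R n i @^-1` `[c, d])).
  apply: fin_bigcap_measurable => // i _.
  by rewrite -[X in measurable X]setTI; exact: measurable_rV_coord.
apply/seteqP; split=> x /= xb i; first by move=> _; rewrite /= in_itv /= xb.
by have := xb i I; rewrite /= in_itv.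
Qed.

(** Induction on the dimension: [rV_cons] pulls the cube back to a segment times a cube of one
    dimension less. In dimension 0 the Dirac mass gives 1. *)
Lemma lebesgue_rV_box n c d : c <= d ->
  lebesgue_rV R n (@box n c d) = ((d - c) ^+ n)%:E.
Proof.
move=> cd; elim: n => [|n IH].
  by rewrite /= diracE mem_set// => -[].
rewrite /= /lebesgue_rV_step /pushforward.
rewrite (_ : _ @^-1` _ = `[c, d]%classic `*` @box n c d); last first.
  apply/seteqP; split=> -[s y] /=; rewrite /rV_cons => sy; first split=> [|i].
  - have := sy (lshift n (ord0 : 'I_1)).
    by rewrite (row_mxEl s%:M) mxE mulr1n in_itv.
  - by have := sy (rshift 1 i); rewrite (row_mxEr s%:M).
  - move: sy => [+ sy] i; rewrite in_itv/=.
    have [j|j] := @split_ordP 1 n i => ij sc; subst i.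
      by rewrite (row_mxEl s%:M) mxE (ord1 j) mulr1n.
    by rewrite (row_mxEr s%:M); exact: sy.
rewrite product_measure1E//; last exact: measurable_box.
rewrite IH [X in (X * _)%E](_ : _ = (d - c)%:E) ?exprS//.
exact: lebesgue_measure_itvcc.
Qed.
End box.

(** * Powers of the positive part *)

(** The difference quotient is within [|h|] of [d]. This covers the square of the positive part at
    its kink together with all other points. *)
Lemma is_derive_quadratic_error (R : realType) (f : R -> R) (x d : R) :
  (forall h, `|f (h + x) - f x - h * d| <= h ^+ 2) -> is_derive x 1 f d.
Proof.
move=> fC.
have cvgd : h^-1 *: (f (h *: 1 + x) - f x) @[h --> 0^'] --> d.
  apply/cvgrPdist_le => e e0; near=> h.
  have h0 : h != 0 by near: h; exact: nbhs_dnbhs_neq.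
  have he : `|h| <= e.
    near: h; apply: dnbhs0_le => //.
  rewrite -(ler_pM2l (_ : 0 < `|h|)) ?normr_gt0// -normrM.
  rewrite (_ : h * _ = - (f (h + x) - f x - h * d)); last first.
    by rewrite /GRing.scale/= mulr1; field.
  rewrite normrN (le_trans (fC h))// -[_ ^+ 2]ger0_norm ?sqr_ge0// normrX expr2.
  by rewrite ler_wpM2l.
have der : derivable f x 1 by apply/cvg_ex; exists d; exact: cvgd.
by apply: DeriveDef => //; apply/cvg_lim.
Unshelve. all: end_near. Qed.

Section pospow.
Variable R : realType.

Definition pospow (k : nat) (y : R) : R := Num.max 0 y ^+ k.

Lemma pospow_ge0 k y : 0 <= pospow k y.
Proof. by rewrite exprn_ge0// le_max lexx. Qed.

(** The extra factor may be [y] itself, because [pospow k.+1 y] vanishes for [y <= 0]. At exponent 0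
    this breaks down, as [pospow 0 y] is 1. *)
Lemma pospowS k y : pospow k.+2 y = y * pospow k.+1 y.
Proof.
rewrite /pospow [LHS]exprS; case: (leP y 0) => y0; last by [].
by rewrite exprS !mul0r mulr0.
Qed.

(** Induction by the product rule through [pospowS]; it starts at the square, the first power
    without a corner at 0. *)
Lemma is_derive_pospow k (y : R) :
  is_derive y 1 (pospow k.+2) (k.+2%:R * pospow k.+1 y).
Proof.
elim: k => [|k IH].
  apply: is_derive_quadratic_error => h; rewrite /pospow !expr2 !expr1.
  rewrite ler_norml; case: (leP y 0) => y0; case: (leP (h + y) 0) => hy0;
    nra.
rewrite (_ : pospow k.+3 = (id : R -> R) * pospow k.+2); last first.
  by apply/funext => z; rewrite pospowS.
apply: is_derive_eq; rewrite /= !pospowS.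
rewrite /GRing.scale/=. ring.
Qed.

Lemma continuous_pospow k : continuous (pospow k).
Proof.
move=> y; have maxC : {for y, continuous (Num.max (0 : R))}.
  by apply: (@continuous_max _ _ (cst 0) id); [exact: cvg_cst|exact: cvg_id].
exact: (continuous_comp maxC (@exprn_continuous R k _)).
Qed.
End pospow.

(** * A weighted Young inequality *)

(* Either y^(p-1) W^2 >= B and the first term suffices, or the second does. *)
Lemma weak_young (R : realType) (p y B W : R) (k : nat) : 1 < p -> 0 <= y ->
  0 < B -> 0 <= W <= 1 -> 2 / (p - 1) <= k%:R ->
  y * B * W ^+ k <= y `^ p * W ^+ k.+2 + B `^ (p / (p - 1)).
Proof.
move=> p1 y0 B0 /andP[W0 W1] kp.
have [->|Wn0] := eqVneq W 0.
  (* For [W = 0] only [k = 0] would leave a nonzero left side, and [0 < 2 / (p - 1) <= k] excludes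
     it. *)
  rewrite expr0n; case: k kp => [|k _]; last first.
    by rewrite mulr0 expr0n mulr0 add0r powR_ge0.
  by rewrite leNgt divr_gt0//; lra.
have Wgt0 : 0 < W by rewrite lt_neqAle eq_sym Wn0.
have [->|yn0] := eqVneq y 0.
  by rewrite !mul0r addr_ge0 ?powR_ge0//; apply: mulr_ge0; [exact: powR_ge0|exact: exprn_ge0].
have ygt0 : 0 < y by rewrite lt_neqAle eq_sym yn0.
have p10 : 0 < p - 1 by lra.
have yp : y `^ p = y * y `^ (p - 1).
  by rewrite -{2}(powRr1 y0) -powRD ?yn0 ?implybT//; congr powR; ring.
have [h|h] := leP B (y `^ (p - 1) * W ^+ 2).
  apply: ler_wpDr; first exact: powR_ge0.
  rewrite yp; have -> : y * y `^ (p - 1) * W ^+ k.+2 =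
      y * W ^+ k * (y `^ (p - 1) * W ^+ 2) by rewrite -addn2 exprD; ring.
  by rewrite mulrAC ler_wpM2l// mulr_ge0// exprn_ge0.
apply: ler_wpDl; first by rewrite mulr_ge0 ?powR_ge0// exprn_ge0.
have Bp : B `^ (p / (p - 1)) = B * B `^ (p - 1)^-1.
  rewrite -{2}(powRr1 (ltW B0)) -powRD ?(gt_eqF B0) ?implybT//; congr powR.
  by field; lra.
rewrite Bp [y * B]mulrC -mulrA ler_pM2l//.
have -> : y = (y `^ (p - 1)) `^ (p - 1)^-1.
  by rewrite -powRrM mulfV ?gt_eqF// powRr1.
apply: (@le_trans _ _ ((y `^ (p - 1)) `^ (p - 1)^-1 * (W ^+ 2) `^ (p - 1)^-1)).
  rewrite ler_wpM2l ?powR_ge0// -powR_mulrn// -powR_mulrn// -powRrM.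
  by rewrite ger_powR ?Wgt0 ?W1.
rewrite -powRM ?powR_ge0 ?exprn_ge0//.
apply: ge0_ler_powR; rewrite ?invr_ge0 ?nnegrE ?(ltW p10) ?(ltW B0) ?(ltW h)//.
by apply: mulr_ge0; [exact: powR_ge0|exact: exprn_ge0].
Qed.

(** * Directional derivatives and continuity *)

(** The two difference quotients are the same function of [h], so the one-variable rules, the chain
    rule in particular, apply along a line. *)
Lemma is_derive_line (R : realType) (V : normedModType R) (f : V -> R) (x v : V)
    (d : R) :
  is_derive x v f d <-> is_derive (0 : R) (1 : R) (fun h : R => f (h *: v + x)) d.
Proof.
suff E : (fun h : R => h^-1 *: ((f \o shift x) (h *: v) - f x)) =
  (fun h : R => h^-1 *: (((fun h : R => f (h *: v + x)) \o shift 0) (h *: (1 : R))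
     - f (0 *: v + x))).
  split=> -[df dv]; apply: DeriveDef.
  - by rewrite /derivable -E.
  - by rewrite /derive -E.
  - by rewrite /derivable E.
  - by rewrite /derive E.
by apply/funext => h /=; rewrite addr0 scale0r add0r [_%:A]mulr1.
Qed.

Lemma is_derive_comp1 (R : realType) (V : normedModType R) (f : R -> R)
    (g : V -> R) (x v : V) (a b : R) :
  is_derive (g x) 1 f a -> is_derive x v g b -> is_derive x v (f \o g) (a * b).
Proof.
move=> fa /is_derive_line gb; apply/is_derive_line.
apply: (@is_derive1_comp R f (fun h : R => g (h *: v + x))) => //.
by rewrite scale0r add0r.
Qed.
(* Pointwise forms over an abstract topological type, for which unification
   does not unfold the neighborhood filter of matrices. *)
Section continuous_fun.
Variables (R : realType) (T : topologicalType).
Implicit Types f g : T -> R.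

Lemma continuous_add f g : continuous f -> continuous g ->
  continuous (fun x => f x + g x).
Proof. by move=> fc gc x; apply: cvgD; [exact: fc|exact: gc]. Qed.

Lemma continuous_mul f g : continuous f -> continuous g ->
  continuous (fun x => f x * g x).
Proof. by move=> fc gc x; apply: cvgM; [exact: fc|exact: gc]. Qed.

Lemma continuous_opp f : continuous f -> continuous (fun x => - f x).
Proof. by move=> fc x; apply: cvgN; exact: fc. Qed.

Lemma continuous_const (c : R) : continuous (fun _ : T => c).
Proof. by move=> x; exact: cvg_cst. Qed.

Lemma continuous_sum n (f : 'I_n -> T -> R) : (forall i, continuous (f i)) ->
  continuous (fun x => \sum_(i < n) f i x).
Proof.
by move=> fc; apply: continuous_big => [|i _]; [exact: add_continuous|exact: fc].
Qed.

End continuous_fun.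

(** * The cutoff in space *)

Section cutoff.
Variables (R : realType) (n : nat) (r : R).
Implicit Types (x : 'rV[R]_n) (i j : 'I_n).

Definition paraboloid x : R := 1 - \sum_(i < n) (x ord0 i / r) ^+ 2.

Lemma is_derive_coord x j i :
  is_derive x (delta_mx ord0 j) (fun y : 'rV[R]_n => y ord0 i) (i == j)%:R.
Proof.
apply/is_derive_line.
rewrite (_ : (fun h : R => _) = (i == j)%:R \*: (id : R -> R) + cst (x ord0 i)).
  by apply: is_derive_eq; rewrite addr0 /GRing.scale/= mulr1.
by apply/funext => h; rewrite !mxE eqxx/= mulrC.
Qed.

Lemma is_derive_paraboloid x j :
  is_derive x (delta_mx ord0 j) paraboloid (- 2 * (x ord0 j / r) / r).
Proof.
rewrite (_ : paraboloid = cst 1 -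
    \sum_(i < n) (r^-1 \*: (fun y : 'rV[R]_n => y ord0 i)) ^+ 2); last first.
  apply/funext => y; rewrite /paraboloid /= fctE /=; congr (_ - _).
  rewrite fct_sumE; apply: eq_bigr => i _; rewrite fctE /GRing.scale /=.
  by rewrite mulrC.
have coordP := is_derive_coord x j.
apply: is_derive_eq; rewrite (bigD1 j)//= big1 ?eqxx => [|i /negbTE ->].
  by rewrite /GRing.scale/=; ring.
by rewrite !scaler0.
Qed.

Definition cutoff k x : R := pospow k (paraboloid x).

Lemma is_derive_cutoff k x j : is_derive x (delta_mx ord0 j) (cutoff k.+2)
  (k.+2%:R * cutoff k.+1 x * (- 2 * (x ord0 j / r) / r)).
Proof.
apply: is_derive_comp1; first exact: is_derive_pospow.
exact: is_derive_paraboloid.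
Qed.

(** Closed forms of the derivatives of [cutoff k.+3] up to order two. The exponent [k.+3] leaves a
    positive power after two differentiations. In [[:: j; i]] the inner derivative is the one along
    [i], as in [partials]; longer lists get the default 0. *)
Definition cutoff_partials k (s : seq 'I_n) x : R :=
  match s with
  | [::] => cutoff k.+3 x
  | [:: i] => k.+3%:R * cutoff k.+2 x * (- 2 * (x ord0 i / r) / r)
  | [:: j; i] => k.+3%:R * (k.+2%:R * cutoff k.+1 x *
       (- 2 * (x ord0 j / r) / r) * (- 2 * (x ord0 i / r) / r) +
       cutoff k.+2 x * (- 2 * ((i == j)%:R / r) / r))
  | _ => 0
  end.

(** The constant [c] is the place of the time factor of the test function at a fixed time. *)
Lemma is_derive_cutoff_partials k c s x j : (size s < 2)%N ->
  is_derive x (delta_mx ord0 j) (fun y => c * cutoff_partials k s y)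
    (c * cutoff_partials k (j :: s) x).
Proof.
case: s => [|i [|//]] _ /=.
  exact: (@is_deriveZ _ _ _ _ c _ _ _ (is_derive_cutoff k.+1 x j)).
have b' := is_derive_cutoff k x j.
have c' := is_derive_coord x j i.
rewrite (_ : (fun _ => _) = (c * k.+3%:R * - 2 / r / r) \*:
    (cutoff k.+2 * (fun y : 'rV[R]_n => y ord0 i))); last first.
  apply/funext => y; rewrite fctE -[RHS]/(_ * (_ * _)); ring.
by apply: is_derive_eq; rewrite /GRing.scale/=; ring.
Qed.

Lemma partials_cutoff k c s : (size s <= 2)%N ->
  partials s (fun x => c * cutoff k.+3 x) = fun x => c * cutoff_partials k s x.
Proof.
elim: s => [//|j s IH] /= s2; rewrite IH; last exact: ltnW.
apply/funext => x; have d := is_derive_cutoff_partials k c x j s2.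
  by rewrite /partial derive_val.
Qed.

Lemma continuous_coord i : continuous (fun x : 'rV[R]_n => x ord0 i).
Proof. exact: coord_continuous. Qed.

Lemma continuous_cutoff k : continuous (cutoff k).
Proof.
have parC : continuous (paraboloid : 'rV[R]_n -> R).
  apply: continuous_add; first exact: continuous_const.
  apply/continuous_opp/continuous_sum => i.
  by apply: continuous_mul; apply: continuous_mul;
    (exact: continuous_coord || exact: continuous_const).
by move=> x; exact: (continuous_comp (parC x) (@continuous_pospow R k _)).
Qed.

Lemma continuous_cutoff_partials k s : continuous (cutoff_partials k s).
Proof.
have scaled_coord i : continuous (fun y : 'rV[R]_n => - 2 * (y ord0 i / r) / r).
  do !apply: continuous_mul; try exact: continuous_const.
  exact: continuous_coord.
have scaled_cutoff c m : continuous (fun y => c * cutoff m y).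
  by apply: continuous_mul; [exact: continuous_const|exact: continuous_cutoff].
case: s => [|j [|i [|? ?]]]; first exact: continuous_cutoff.
- exact: continuous_mul.
- apply: continuous_mul; first exact: continuous_const.
  apply: continuous_add; first by apply: continuous_mul => //; exact: continuous_mul.
  by apply: continuous_mul; [exact: continuous_cutoff|exact: continuous_const].
- exact: continuous_const.
Qed.

Lemma Ck2_cutoff k c : Ck 2 (fun x => c * cutoff k.+3 x).
Proof.
move=> s; split=> s2.
  move=> i x; rewrite partials_cutoff//; last exact: ltnW.
  by have d := is_derive_cutoff_partials k c x i s2; exact: ex_derive.
rewrite partials_cutoff//; apply: continuous_mul; first exact: continuous_const.
exact: continuous_cutoff_partials.
Qed.

Hypothesis r1 : 1 <= r.

Lemma paraboloid_le1 x : paraboloid x <= 1.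
Proof. by rewrite lerBlDl lerDr sumr_ge0// => i _; exact: sqr_ge0. Qed.

Lemma paraboloid_coord x i : 0 <= paraboloid x -> `|x ord0 i / r| <= 1.
Proof.
rewrite subr_ge0 => P; rewrite -(@expr_le1 _ 2)// -normrX ger0_norm ?sqr_ge0//.
rewrite (le_trans _ P)// (bigD1 i)//= lerDl sumr_ge0// => j _.
exact: sqr_ge0.
Qed.

Lemma cutoff_ge0 k x : 0 <= cutoff k x. Proof. exact: pospow_ge0. Qed.

Lemma cutoff_le1 k x : cutoff k x <= 1.
Proof.
by rewrite /cutoff /pospow exprn_ile1 ?le_max ?lexx// ge_max ler01 paraboloid_le1.
Qed.

Lemma cutoffS k x : cutoff k.+1 x <= cutoff k x.
Proof.
rewrite /cutoff /pospow exprS ler_piMl ?exprn_ge0 ?le_max ?lexx//.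
by rewrite ge_max ler01 paraboloid_le1.
Qed.

Lemma cutoff_eq0 k x : paraboloid x <= 0 -> cutoff k.+1 x = 0.
Proof. by move=> P; rewrite /cutoff /pospow max_l// expr0n. Qed.

(** On the ball each differentiation costs one power of the cutoff and a slope of at most [2 / r];
    off it everything vanishes. With [N = k.+3] the second order gives at most
    [4 N (N - 1) / r + 2 N / r], where [r^-1 <= 1] has reduced the squares of [r^-1]. *)
Lemma cutoff_partials_le k s x : (0 < size s <= 2)%N ->
  `|cutoff_partials k s x| <= 6 * k.+3%:R ^+ 2 / r * cutoff k.+1 x.
Proof.
have [P0|/ltW P0] := leP (paraboloid x) 0.
  case: s => [//|i [|j [|//]]] _ /=; rewrite !cutoff_eq0//.
  - by rewrite !(mulr0, mul0r) normr0.
  - by rewrite !(mulr0, mul0r) addr0 mulr0 normr0.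
have r0 : 0 < r := lt_le_trans ltr01 r1.
set N : R := k.+3%:R; set q := r^-1.
have N1 : 1 <= N by rewrite ler1n.
have kN : k.+2%:R = N - 1 by rewrite /N [in RHS]mulrS addrAC subrr add0r.
have q0 : 0 < q by rewrite invr_gt0.
have q1 : q <= 1 by rewrite invf_le1.
have slope (y : R) : `|y| <= 1 -> `|- 2 * y * q| <= 2 * q.
  move=> y1; rewrite !normrM normrN (@ger0_norm _ 2)// (@ger0_norm _ q) ?(ltW q0)//.
  by rewrite ler_pM2r// ler_piMr.
have xr i := slope _ (paraboloid_coord i P0).
have b0 := cutoff_ge0 k.+1 x; have b1 := cutoffS k.+1 x.
have b2 := cutoff_ge0 k.+2 x.
have N0 : 0 <= N by lra.
have qb : 0 <= q * cutoff k.+1 x by rewrite mulr_ge0// ltW.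
have nqb : 0 <= N * (q * cutoff k.+1 x) by rewrite mulr_ge0.
have nqbN : N * (q * cutoff k.+1 x) <= N * (N * (q * cutoff k.+1 x)).
  by rewrite ler_peMl.
case: s => [//|j [|i [|//]]] _ /=; rewrite -/N -/q.
  rewrite normrM (ger0_norm (mulr_ge0 N0 b2)).
  apply: (@le_trans _ _ (N * cutoff k.+1 x * (2 * q))).
    apply: ler_pM; [exact: mulr_ge0|exact: normr_ge0| |exact: xr].
    by rewrite ler_wpM2l.
  lra.
rewrite normrM (@ger0_norm _ N)//.
apply: (@le_trans _ _ (N * ((N - 1) * cutoff k.+1 x * (2 * q) * (2 * q) +
  cutoff k.+1 x * (2 * q)))).
  rewrite ler_wpM2l// (le_trans (ler_normD _ _))//; apply: lerD.
    have nb0 : 0 <= (N - 1) * cutoff k.+1 x by rewrite mulr_ge0// subr_ge0.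
    rewrite kN 2!normrM (ger0_norm nb0).
    apply: ler_pM (xr i); [by apply: mulr_ge0|exact: normr_ge0|].
    by apply: ler_wpM2l => //; exact: xr.
  rewrite normrM (@ger0_norm _ (cutoff _ _))//.
  apply: ler_pM => //; apply: slope; rewrite ger0_norm ?mulr_ge0//; last lra.
  by case: (i == j); rewrite ?mul1r ?mul0r.
have : N * ((N - 1) * (q * (q * cutoff k.+1 x))) <= N * ((N - 1) * (q * cutoff k.+1 x)).
  by rewrite !ler_wpM2l ?ler_piMl//; lra.
lra.
Qed.
End cutoff.

(** * Bounding [laplacianX] by derivatives of its argument *)

Lemma ler_norm_sum_ord (R : realType) n (f : 'I_n -> R) (M : R) :
  (forall i, `|f i| <= M) -> `|\sum_(i < n) f i| <= n%:R * M.
Proof.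
move=> fM; rewrite (le_trans (ler_norm_sum _ _ _))//.
rewrite (le_trans (ler_sum _ (fun i _ => fM i)))//.
by rewrite sumr_const card_ord mulr_natl.
Qed.

Section laplacian_bound.
Variables (R : realType) (n : nat).

Lemma vfield_le (b : 'I_n -> 'rV[R]_n -> R) g x (A N : R) :
  (forall i, `|b i x| <= A) -> (forall i, `|partial i g x| <= N) ->
  `|vfield b g x| <= n%:R * (A * N).
Proof.
move=> bA gN; apply: ler_norm_sum_ord => i.
by rewrite normrM ler_pM.
Qed.

Lemma partial_vfield (b : 'I_n -> 'rV[R]_n -> R) g i x :
  (forall j, smooth (b j)) -> Ck 2 g ->
  partial i (vfield b g) x = \sum_(j < n)
    (b j x * partial i (partial j g) x + partial j g x * partial i (b j) x).
Proof.
move=> sb g2.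
have db j : is_derive x (delta_mx ord0 i) (b j) (partial i (b j) x).
  by apply: DeriveDef => //; have [+ _] := sb j 1 [::]; exact.
have dg j : is_derive x (delta_mx ord0 i) (partial j g) (partial i (partial j g) x).
  by apply: DeriveDef => //; have [+ _] := g2 [:: j]; exact.
rewrite {1}/partial.
rewrite (_ : vfield b g = \sum_(j < n) (b j * partial j g)); last first.
  by apply/funext => y; rewrite fct_sumE.
by rewrite derive_val.
Qed.

(** Expanding, each summand is [X_k (X_k g) + (div X_k) X_k g]: only derivatives of [g] of order one
    and two occur, with bounded coefficients. The absence of [g] itself is essential, since the
    cutoff is small in its derivatives only. *)
Lemma laplacianX_le m (a : 'I_m -> 'I_n -> 'rV[R]_n -> R) :
  (forall k i, smooth (a k i)) ->
  (forall k i, [bounded a k i x | x in [set: 'rV[R]_n]]) ->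
  (forall k i j, [bounded partial i (a k j) x | x in [set: 'rV[R]_n]]) ->
  exists2 C : R, 0 < C & forall g x N, Ck 2 g -> 0 <= N ->
    (forall s, (0 < size s <= 2)%N -> `|partials s g x| <= N) ->
    `|laplacianX a g x| <= C * N.
Proof.
move=> sa ba bda.
have [A A0 [aA daA]] : exists2 A : R, 0 <= A &
    (forall k i x, `|a k i x| <= A) /\
    (forall k i j x, `|partial i (a k j) x| <= A).
  (* Boundedness holds for all large [A], and finitely many such conditions, one for each choice of
     indices, hold simultaneously. *)
  have Fa : \forall A \near +oo, forall k i x, `|a k i x| <= A.
    apply: filter_forall => k; apply: filter_forall => i.
    by have := ba k i; apply: (@filterS _ (pinfty_nbhs R) _) => A aA x; exact: aA.
  have Fda : \forall A \near +oo, forall k i j x, `|partial i (a k j) x| <= A.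
    apply: filter_forall => k; apply: filter_forall => i; apply: filter_forall => j.
    by have := bda k i j; apply: (@filterS _ (pinfty_nbhs R) _) => A aA x; exact: aA.
  near (pinfty_nbhs R) => A; exists A; first by near: A; exact: nbhs_pinfty_ge.
  by split; near: A.
(* The two summands bound [X_k (X_k g)] and [(div X_k) X_k g]; the [+ 1] keeps the constant positive
   when [m] or [A] is 0. *)
exists (m%:R * (n%:R * (A * (n%:R * (A + A))) + n%:R * A * (n%:R * A)) + 1).
  by rewrite ltr_wpDl// !(mulr_ge0, addr_ge0).
move=> g x N g2 N0 gN.
apply: (@le_trans _ _ (m%:R * (n%:R * (A * (n%:R * (A * N + N * A))) +
  n%:R * A * (n%:R * (A * N))))); last first.
  nra.
rewrite normrN; apply: ler_norm_sum_ord => k.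
rewrite /vfield_adj -opprD normrN (le_trans (ler_normD _ _))//; apply: lerD.
  apply: vfield_le => // i; rewrite partial_vfield//.
  apply: ler_norm_sum_ord => j; rewrite (le_trans (ler_normD _ _))//.
  rewrite !normrM; apply: lerD; apply: ler_pM => //.
    exact: (gN [:: i; j]).
  exact: (gN [:: j]).
rewrite normrM; apply: ler_pM => //; first exact: ler_norm_sum_ord.
by apply: vfield_le => // i; exact: (gN [:: i]).
Unshelve. all: end_near. Qed.
End laplacian_bound.

(** * The cutoff in time *)

Section timecut.
Variables (R : realType) (T : R).
Hypothesis T0 : 0 < T.

(* Supported in [0, T/2] and zero at 0, which eliminates the initial datum. *)
Definition timecut k (t : R) : R := pospow k (1 - (4 / T * t - 1) ^+ 2).

Definition timecut' k (t : R) : R :=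
  k.+2%:R * timecut k.+1 t * (- 2 * (4 / T * t - 1) * (4 / T)).

Lemma is_derive_timecut k t : is_derive (t : R) (1 : R) (timecut k.+2) (timecut' k t).
Proof.
apply: is_derive1_comp; first exact: is_derive_pospow.
rewrite (_ : (fun t : R => _) = cst 1 - (((4 / T) \*: (id : R -> R)) - cst 1) ^+ 2) //.
apply: is_derive_eq; rewrite subr0 sub0r -[((4 / T) \*: _ - _) t]/(4 / T * t - 1).
rewrite /GRing.scale/=; ring.
Qed.

Lemma continuous_timecut k : continuous (timecut k).
Proof.
move=> t; apply: (@continuous_comp _ _ _ (fun t : R => 1 - (4 / T * t - 1) ^+ 2)
  (pospow k)); last exact: continuous_pospow.
apply: continuous_add; first exact: continuous_const.
apply: continuous_opp; apply: continuous_mul; apply: continuous_add;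
  try exact: continuous_const; apply: continuous_mul;
  try exact: continuous_const; move=> ?; exact: cvg_id.
Qed.

Lemma continuous_timecut' k : continuous (timecut' k).
Proof.
apply: continuous_mul.
  by apply: continuous_mul; [exact: continuous_const|exact: continuous_timecut].
apply: continuous_mul; last exact: continuous_const.
apply: continuous_mul; first exact: continuous_const.
apply: continuous_add; last exact: continuous_const.
by apply: continuous_mul; [exact: continuous_const|move=> ?; exact: cvg_id].
Qed.

Lemma timecut_ge0 k t : 0 <= timecut k t. Proof. exact: pospow_ge0. Qed.

Lemma timecut_le1 k t : timecut k t <= 1.
Proof.
by rewrite /timecut /pospow exprn_ile1 ?le_max ?lexx// ge_max ler01 gerBl sqr_ge0.
Qed.

Lemma timecutS k t : timecut k.+1 t <= timecut k t.
Proof.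
rewrite /timecut /pospow exprS ler_piMl ?exprn_ge0 ?le_max ?lexx//.
by rewrite ge_max ler01 gerBl sqr_ge0.
Qed.

Lemma timecut0 k : timecut k.+1 0 = 0.
Proof. by rewrite /timecut /pospow mulr0 sub0r sqrrN expr1n subrr maxxx expr0n. Qed.

Lemma timecut_support k t : timecut k.+1 t != 0 -> t <= T / 2.
Proof.
apply: contraNT; rewrite -ltNge => tT; apply/eqP.
rewrite /timecut /pospow max_l ?expr0n// subr_le0.
have : 2 < 4 / T * t by rewrite mulrAC ltr_pdivlMr//; lra.
set z := 4 / T * t => z2; nra.
Qed.

Lemma timecut'_le k t : `|timecut' k t| <= 8 * k.+2%:R / T * timecut k.+1 t.
Proof.
have [s0|/ltW s0] := leP (1 - (4 / T * t - 1) ^+ 2) 0.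
  by rewrite /timecut' /timecut /pospow max_l// expr0n !(mulr0, mul0r) normr0.
have s1 : `|4 / T * t - 1| <= 1.
  by rewrite -(@expr_le1 _ 2)// -normrX ger0_norm ?sqr_ge0// -subr_ge0.
rewrite /timecut' normrM ger0_norm; last by apply: mulr_ge0 => //; exact: timecut_ge0.
rewrite (_ : 8 * _ / T * _ = k.+2%:R * timecut k.+1 t * (2 * 1 * (4 / T))); last by ring.
apply: ler_wpM2l; first by apply: mulr_ge0 => //; exact: timecut_ge0.
have T4 : 0 <= 4 / T by rewrite divr_ge0// ltW.
rewrite !normrM normrN (@ger0_norm _ 2)// -normrM (ger0_norm T4).
by rewrite ler_wpM2r// ler_wpM2l.
Qed.
End timecut.

(** * Admissibility of the test function *)

Section testfun.
Variables (R : realType) (n : nat) (T r : R) (k : nat).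
Hypothesis T0 : 0 < T.
Hypothesis r1 : 1 <= r.

Definition testfun (t : R) (x : 'rV[R]_n) : R := timecut T k.+3 t * cutoff r k.+3 x.

Lemma cutoff_partials_bounded : exists2 M : R, 0 < M & forall s (x : 'rV[R]_n),
  (size s <= 2)%N -> `|cutoff_partials r k s x| <= M.
Proof.
exists (6 * k.+3%:R ^+ 2 + 1) => [|s x s2]; first by rewrite ltr_wpDl ?mulr_ge0.
case: (posnP (size s)) => [/size0nil -> /=|s0].
  rewrite ger0_norm ?cutoff_ge0// (le_trans (cutoff_le1 _ _ _))// lerDr.
  by rewrite mulr_ge0 ?exprn_ge0.
rewrite (le_trans (cutoff_partials_le r1 _ _ _))//; first by rewrite s0.
rewrite ler_wpDr// -[leRHS]mulr1; apply: ler_pM.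
- by rewrite !mulr_ge0// invr_ge0 (le_trans ler01).
- exact: cutoff_ge0.
- by rewrite ler_piMr ?mulr_ge0 ?exprn_ge0// invf_le1// (lt_le_trans ltr01).
- exact: cutoff_le1.
Qed.

(** Separation of variables: closeness in the C^2 norm reduces to closeness of the scalar time
    factors. This yields both time conditions in [test_function]. *)
Lemma C2_close_cutoff (c d e M : R) : 0 < M ->
  (forall s (x : 'rV[R]_n), (size s <= 2)%N -> `|cutoff_partials r k s x| <= M) ->
  `|c - d| <= e / M ->
  C2_close e (fun x : 'rV[R]_n => c * cutoff r k.+3 x) (fun x => d * cutoff r k.+3 x).
Proof.
move=> M0 pM cd s s2 x; rewrite !partials_cutoff// -mulrBl normrM.
rewrite (_ : e = e / M * M); last by rewrite divfK ?gt_eqF.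
by apply: ler_pM => //; exact: pM.
Qed.

Lemma testfun_test_function : test_function T testfun.
Proof.
have [M M0 pM] := cutoff_partials_bounded.
split; last split.
(* The compact set is a cube containing the ball of radius [r]. *)
- exists (T / 2), (@box R n (- r) r); split.
  + by rewrite ltr_pdivrMr// ltr_pMr// ltr1n.
  + have := @rV_compact R n (fun=> `[- r, r]%classic) (fun=> @segment_compact R (- r) r).
    by congr compact; apply/seteqP; split=> x /= xb i; have := xb i; rewrite in_itv.
  + move=> t x _; rewrite mulf_eq0 negb_or => /andP[tT xb].
    split; first exact: timecut_support tT.
    have [P0|/ltW P0] := leP (paraboloid r x) 0.
      by rewrite cutoff_eq0 ?eqxx in xb.
    move=> i; have := paraboloid_coord i P0.
    rewrite -ler_norml normrM normfV (@ger0_norm _ r) ?(le_trans ler01)//.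
    by rewrite ler_pdivrMr ?mul1r// (lt_le_trans ltr01).
- by move=> t _; exact: Ck2_cutoff.
- exists (fun t x => timecut' T k.+1 t * cutoff r k.+3 x); split.
  + by move=> t _; exact: Ck2_cutoff.
  + move=> t e _ e0; have [dt vt] := is_derive_timecut T k.+1 t.
    have eM : 0 < e / M by rewrite divr_gt0.
    have cvgd : h^-1 *: (timecut T k.+3 (h *: 1 + t) - timecut T k.+3 t)
        @[h --> 0^'] --> timecut' T k.+1 t by rewrite -vt; exact: dt.
    have /cvgrPdist_le /(_ _ eM) /nbhs_ballP[d /= d0 dP] := cvgd.
    exists d => // s _ st sd.
    rewrite (_ : (fun x => _) = fun x => ((timecut T k.+3 s - timecut T k.+3 t) /
      (s - t)) * cutoff r k.+3 x); last by apply/funext => x; rewrite /testfun; ring.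
    apply: (C2_close_cutoff M0) => //.
    have := dP (s - t); rewrite /ball/= sub0r normrN subr_eq0.
    rewrite [_%:A]mulr1 subrK => /(_ sd st).
    by rewrite distrC [_ *: _]mulrC.
  + move=> t e _ e0.
    have eM : 0 < e / M by rewrite divr_gt0.
    have /cvgrPdist_le /(_ _ eM) := @continuous_timecut' R T k.+1 t.
    move=> /nbhs_ballP[d /= d0 dP].
    exists d => // s _ st; apply: (C2_close_cutoff M0) => //.
    by rewrite distrC; apply: dP; rewrite /ball/= distrC.
Qed.
End testfun.

(** * Iterated integrals over the slab *)

Section slab.
Variables (R : realType) (n : nat) (T : R).
Local Notation leb1 := (@lebesgue_measure R).
Local Notation leb := (lebesgue_rV R n).
Variable h : measurableTypeR R * 'rV[R]_n -> R.
Hypothesis mh : measurable_fun (`]0, T[ `*` [set: 'rV[R]_n]) h.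
Hypothesis h0 : forall z, 0 <= h z.

(** Extension by zero: [h] is assumed measurable on the slab, while Tonelli's theorem is applied on
    the whole product. *)
Let H : measurableTypeR R * 'rV[R]_n -> \bar R := (EFin \o h) \_ (`]0, T[ `*` [set: 'rV[R]_n]).

Let mH : measurable_fun [set: measurableTypeR R * 'rV[R]_n] H.
Proof.
apply/(measurable_restrictT _ _).1.
  by apply: measurableX.
exact/measurable_EFinP.
Qed.

Let H0 z : (0 <= H z)%E.
Proof. by rewrite /H patchE; case: ifPn => // _; rewrite /= lee_fin. Qed.

Let HE t x : `]0, T[%classic t -> H (t, x) = (h (t, x))%:E.
Proof. by move=> tT; rewrite /H patchE mem_set. Qed.

Lemma measurable_slab_slice t : `]0, T[%classic t ->
  measurable_fun setT (fun x => h (t, x)).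
Proof.
move=> tT; apply/measurable_EFinP.
rewrite (_ : _ \o _ = H \o pair t); first exact: measurableT_comp.
by apply/funext => x /=; rewrite HE.
Qed.

Lemma measurable_slab_integral :
  measurable_fun (`]0, T[ : set (measurableTypeR R)) (fun t => \int[leb]_x (h (t, x))%:E)%E.
Proof.
have := measurable_fun_fubini_tonelli_F (m2 := leb) H mH H0.
move/(measurable_funS measurableT (@subsetT _ `]0, T[%classic)).
apply: eq_measurable_fun => t /set_mem tT.
by rewrite /fubini_F; apply: eq_integral => x _; rewrite HE.
Qed.

(** Carries a pointwise Young bound over to the weak formulation: the modulus passes through the two
    integrals by [le_integral_abs], and the indicator contributes the volume [(2 * r) ^+ n] times
    the length [T]. *)
Lemma slab_integral_le (E r : R) (g : R -> 'rV[R]_n -> R) : 0 < T -> 0 <= E ->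
  0 <= r ->
  (forall t x, `]0, T[%classic t ->
    `|g t x| <= 2^-1 * h (t, x) + E * \1_(@box R n (- r) r) x) ->
  (`|\int[leb1]_(t in `]0%R, T[) \int[leb]_x (g t x)%:E| <=
    (2^-1)%:E * \int[leb1]_(t in `]0%R, T[) \int[leb]_x (h (t, x))%:E +
    (E * (2 * r) ^+ n * T)%:E)%E.
Proof.
move=> T0 E0 r0 gh.
pose S t := (\int[leb]_x (h (t, x))%:E)%E.
have S0 t : (0 <= S t)%E by apply: integral_ge0 => x _; rewrite lee_fin.
have mbox := @measurable_box R n (- r) r.
have inner t : `]0, T[%classic t ->
    (\int[leb]_x (2^-1 * h (t, x) + E * \1_(@box R n (- r) r) x)%:E =
     (2^-1)%:E * S t + (E * (2 * r) ^+ n)%:E)%E.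
  move=> tT; have mt := measurable_slab_slice tT.
  under eq_integral do rewrite EFinD !EFinM.
  rewrite ge0_integralD//=; last 4 first.
  - by move=> x _; rewrite -EFinM lee_fin mulr_ge0.
  - apply: measurable_funeM; exact/measurable_EFinP.
  - by move=> x _; rewrite -EFinM lee_fin mulr_ge0.
  - by apply: measurable_funeM; apply/measurable_EFinP; exact: measurable_indic.
  rewrite !ge0_integralZl//=; last 3 first.
  - by apply/measurable_EFinP; exact: measurable_indic.
  - exact/measurable_EFinP.
  - by move=> x _; rewrite lee_fin.
  rewrite integral_indic// setIT.
  rewrite [X in (E%:E * X)%E](_ : _ = ((r - - r) ^+ n)%:E); last first.
    by apply: lebesgue_rV_box; lra.
  by rewrite EFinM opprK -mulr2n mulr_natl.
apply: (@le_trans _ _ (\int[leb1]_(t in `]0%R, T[)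
    ((2^-1)%:E * S t + (E * (2 * r) ^+ n)%:E)))%E.
  apply: le_integral_abs => t tT; rewrite -(inner t tT).
  by apply: le_integral_abs => x _; rewrite lee_fin; exact: gh.
rewrite ge0_integralD//=; last 3 first.
- by move=> t _; rewrite mule_ge0.
- by apply: measurable_funeM; exact: measurable_slab_integral.
- by move=> t _; rewrite lee_fin !mulr_ge0// exprn_ge0// mulr_ge0.
rewrite ge0_integralZl//=; last exact: measurable_slab_integral.
rewrite leeD2l// integral_cst//= lebesgue_measure_itv/= lte_fin T0 sube0.
by rewrite -EFinM.
Qed.
End slab.

(** * Lower bounds on the test function and on integrals *)

(** As [h] is nonnegative only almost everywhere, it is first replaced by its modulus, which
    dominates [c] times the indicator of [B] almost everywhere. *)
Lemma ge_measure_integral d (T : measurableType d) (R : realType)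
    (mu : {measure set T -> \bar R}) (B : set T) (h : T -> R) (c : R) :
  measurable B -> measurable_fun setT h -> 0 <= c ->
  {ae mu, forall x, 0 <= h x} -> {ae mu, forall x, B x -> c <= h x} ->
  (c%:E * mu B <= \int[mu]_x (h x)%:E)%E.
Proof.
move=> mB mh c0 h0 hB.
rewrite (ae_eq_integral (fun x => `|h x|%:E))//; last 3 first.
- exact/measurable_EFinP.
- by apply/measurable_EFinP; exact: measurableT_comp.
- by apply: filterS h0 => x h0 _; rewrite ger0_norm.
rewrite -[B]setIT -integral_indic// -ge0_integralZl//=; last first.
  by apply/measurable_EFinP; exact: measurable_indic.
apply: ae_ge0_le_integral => //=.
- by move=> x _; rewrite -EFinM lee_fin mulr_ge0.
- by apply: measurable_funeM; apply/measurable_EFinP; exact: measurable_indic.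
- by apply/measurable_EFinP; exact: measurableT_comp.
apply: filterS hB => x hB _; rewrite -EFinM lee_fin indicE.
case: (boolP (x \in B)) => [/set_mem/hB|_]; last by rewrite mulr0.
by rewrite mulr1 => /le_trans; apply; exact: ler_norm.
Qed.

Lemma measurable_timecut (R : realType) (T : R) k :
  measurable_fun setT (timecut T k).
Proof. by apply: continuous_measurable_fun; exact: continuous_timecut. Qed.

Lemma measurable_cutoff (R : realType) n (r : R) k :
  measurable_fun setT (@cutoff R n r k).
Proof.
apply: (@measurableT_comp _ _ _ _ _ _ (pospow k)).
  by apply: continuous_measurable_fun; exact: continuous_pospow.
apply: measurable_funB => //; apply: measurable_sum => i.
apply: measurable_funX; apply: measurable_funM => //.
exact: measurable_rV_coord.
Qed.

Section testfun_bounds.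
Variables (R : realType) (n : nat) (T : R) (k : nat).
Hypothesis n0 : (0 < n)%N.
Hypothesis T4n : 4 * n%:R <= T.
Let n1 : 1 <= n%:R :> R. Proof. by rewrite ler1n. Qed.
Let T0 : 0 < T. Proof. by rewrite (lt_le_trans _ T4n)// mulr_gt0// ltr0n. Qed.

(** The sum is at most [n (T / (2 n))^2 = T^2 / (4 n)]. On this cube, of side [T / (4 n) >= 1], both
    the source and the cutoff are bounded below. *)
Lemma sum_sqr_le (x : 'rV[R]_n) :
  box (T / (4 * n%:R)) (T / (2 * n%:R)) x -> \sum_i x ord0 i ^+ 2 <= T ^+ 2 / 2.
Proof.
have nR1 := n1; move=> xb; apply: (@le_trans _ _ (\sum_(i < n) (T / (2 * n%:R)) ^+ 2)).
  apply: ler_sum => i _; have /andP[x1 x2] := xb i.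
  have x0 : 0 <= x ord0 i by rewrite (le_trans _ x1)// divr_ge0 ?ltW// mulr_gt0// ltr0n.
  by rewrite ler_sqr ?nnegrE// (le_trans x0).
rewrite sumr_const card_ord -[_ *+ n]mulr_natl.
rewrite (_ : _ * _ = T ^+ 2 / 2 * (2 * n%:R)^-1); last by field; lra.
rewrite ler_piMr ?divr_ge0 ?sqr_ge0// invf_le1 //; lra.
Qed.

Lemma enorm_box (x : 'rV[R]_n) :
  box (T / (4 * n%:R)) (T / (2 * n%:R)) x -> 1 <= enorm x <= T.
Proof.
move=> xb; have TR4n := T4n; have nR1 := n1; have TR0 := T0; apply/andP; split.
  rewrite -[leLHS]sqrtr1 ler_wsqrtr//.
  have /andP[x1 _] := xb (Ordinal n0).
  rewrite (bigD1 (Ordinal n0))//= ler_wpDr ?sumr_ge0// => [i _|].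
    exact: sqr_ge0.
  rewrite -[leLHS](expr1n _ 2) ler_sqr ?nnegrE//.
  - rewrite (le_trans _ x1)// ler_pdivlMr ?mul1r//; lra.
  - by rewrite (le_trans _ x1)// divr_ge0 ?ltW// mulr_gt0// ltr0n.
rewrite -[leRHS](ger0_norm (ltW TR0)) -sqrtr_sqr ler_wsqrtr//.
rewrite (le_trans (sum_sqr_le xb))// ler_pdivrMr// ler_peMr ?sqr_ge0//; lra.
Qed.

(** Both quadratic polynomials are at least 1/2 here: [4 / T * t - 1] lies in [[-1/2, 1/2]], and
    [sum_sqr_le] bounds the sum in the paraboloid by 1/2. *)
Lemma testfun_ge t (x : 'rV[R]_n) : T / 8 <= t <= 3 / 8 * T ->
  box (T / (4 * n%:R)) (T / (2 * n%:R)) x -> 4^-1 ^+ k.+3 <= testfun T T k t x.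
Proof.
have TR0 := T0; move=> /andP[t1 t2] xb; rewrite (_ : 4^-1 = 2^-1 * 2^-1 :> R); last by field.
rewrite exprMn; apply: ler_pM; rewrite ?exprn_ge0// ?invr_ge0//.
  apply: lerXn2r; rewrite ?nnegrE ?invr_ge0// le_max ?lexx//.
  apply/orP; right.
  have : - 2^-1 <= 4 / T * t - 1 <= 2^-1.
    rewrite lerBrDr lerBlDr mulrAC ler_pdivlMr// ler_pdivrMr//; lra.
  move: (4 / T * t - 1) => z z1; nra.
apply: lerXn2r; rewrite ?nnegrE ?invr_ge0// le_max ?lexx//.
apply/orP; right; rewrite lerBrDr -lerBrDl.
under eq_bigr do rewrite exprMn.
rewrite -mulr_suml exprVn ler_pdivrMr ?exprn_gt0//.
rewrite (le_trans (sum_sqr_le xb))//; lra.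
Qed.
End testfun_bounds.

(** * Derivatives of the test function and absorption *)

Section testfun_derivatives.
Variables (R : realType) (n : nat) (T r : R) (k : nat).
Hypothesis T0 : 0 < T.
Hypothesis r1 : 1 <= r.

Lemma timecut_le2 t : timecut T k.+3 t <= timecut T k.+1 t.
Proof. by rewrite (le_trans (timecutS _ _ _))// timecutS. Qed.

(** Only one power of [timecut] is lost by differentiating; further powers are given up to reach the
    weight common with [partials_testfun_le]. *)
Lemma derive1_testfun_le t (x : 'rV[R]_n) :
  `|derive1 (testfun T r k ^~ x) t| <=
    8 * k.+3%:R / T * (timecut T k.+1 t * cutoff r k.+1 x).
Proof.
have dt := is_derive_timecut T k.+1 t.
rewrite (_ : testfun T r k ^~ x = cutoff r k.+3 x \*: timecut T k.+3); last first.
  by apply/funext => s; rewrite /testfun mulrC.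
rewrite derive1E derive_val normrM mulrC mulrA (ger0_norm (cutoff_ge0 _ _ _)).
apply: ler_pM; rewrite ?cutoff_ge0//.
  rewrite (le_trans (timecut'_le T0 _ _))//.
  by rewrite ler_wpM2l ?timecutS// divr_ge0 ?mulr_ge0// ltW.
by rewrite (le_trans (cutoffS _ _ _))// cutoffS.
Qed.

Lemma partials_testfun_le t s (x : 'rV[R]_n) : (0 < size s <= 2)%N ->
  `|partials s (testfun T r k t) x| <=
    6 * k.+3%:R ^+ 2 / r * (timecut T k.+1 t * cutoff r k.+1 x).
Proof.
move=> s2; rewrite partials_cutoff; last by case/andP : s2.
rewrite normrM (ger0_norm (timecut_ge0 _ _ _)) mulrCA.
apply: ler_pM; rewrite ?timecut_ge0 ?timecut_le2//.
exact: cutoff_partials_le.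
Qed.

Lemma testfun_ge0 t (x : 'rV[R]_n) : 0 <= testfun T r k t x.
Proof. by apply: mulr_ge0; [exact: timecut_ge0|exact: cutoff_ge0]. Qed.

(** [weak_young] with [B = 2 * K], then halved: the factor 1/2 before the power of [u] lets two such
    terms be absorbed by a single integral. *)
Lemma young_testfun p (u c K : R) t (x : 'rV[R]_n) : 1 < p -> 0 < K ->
  2 / (p - 1) <= k.+1%:R ->
  `|c| <= K * (timecut T k.+1 t * cutoff r k.+1 x) ->
  `|u * c| <= 2^-1 * (`|u| `^ p * testfun T r k t x) +
    2^-1 * (2 * K) `^ (p / (p - 1)) * \1_(@box R n (- r) r) x.
Proof.
move=> p1 K0 kp cK.
have [P0|/ltW P0] := leP (paraboloid r x) 0.
  move: cK; rewrite cutoff_eq0// !mulr0 normr_le0 => /eqP ->.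
  rewrite mulr0 normr0; apply: addr_ge0; apply: mulr_ge0 => //.
    by apply: mulr_ge0; [exact: powR_ge0|exact: testfun_ge0].
  by apply: mulr_ge0 => //; exact: powR_ge0.
rewrite indicE mem_set ?mulr1; last first.
  move=> i; have := paraboloid_coord i P0.
  rewrite -ler_norml normrM normfV (@ger0_norm _ r) ?(le_trans ler01)//.
  by rewrite ler_pdivrMr ?mul1r// (lt_le_trans ltr01).
(* In terms of this single weight the test function is [W ^+ k.+3] and the bound on [c] is
   [K * W ^+ k.+1], the two exponents of [weak_young]. *)
set W := timecut T 1 t * cutoff r 1 x.
have WE m : timecut T m t * cutoff r m x = W ^+ m.
  by rewrite /W /timecut /cutoff /pospow !expr1 exprMn.
have W01 : 0 <= W <= 1.
  apply/andP; split; first by apply: mulr_ge0; [exact: timecut_ge0|exact: cutoff_ge0].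
  by apply: mulr_ile1; rewrite ?timecut_ge0 ?cutoff_ge0 ?timecut_le1 ?cutoff_le1.
have K20 : 0 < 2 * K by rewrite mulr_gt0.
have := weak_young p1 (normr_ge0 u) K20 W01 kp.
rewrite /testfun WE; rewrite WE in cK.
have : `|u * c| <= `|u| * (K * W ^+ k.+1) by rewrite normrM ler_wpM2l.
lra.
Qed.
End testfun_derivatives.

Lemma measurable_testfun_slab (R : realType) n (p T r : R) k
    (u : R -> 'rV[R]_n -> R) :
  measurable_fun (`]0, T[ `*` [set: 'rV[R]_n])
    (fun z : measurableTypeR R * 'rV[R]_n => u z.1 z.2) ->
  measurable_fun (`]0, T[ `*` [set: 'rV[R]_n])
    (fun z : measurableTypeR R * 'rV[R]_n =>
      `|u z.1 z.2| `^ p * testfun T r k z.1 z.2).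
Proof.
move=> mu; apply: measurable_funM.
  apply: (measurableT_comp (measurable_powR p)).
  exact: measurableT_comp.
apply: measurable_funS (@subsetT _ _) _ => //.
apply: measurable_funM.
  exact: (measurableT_comp (measurable_timecut T _) measurable_fst).
exact: (measurableT_comp (measurable_cutoff _ _) measurable_snd).
Qed.

(* In the extended reals a vanishing sum has finite terms, since
   [-oo] absorbs. *)
Lemma absorb_le (R : realType) (A F B D : \bar R) (L E : R) :
  (0 <= A)%E -> (L%:E <= F)%E ->
  (`|B| <= (2^-1)%:E * A + E%:E)%E -> (`|D| <= (2^-1)%:E * A + E%:E)%E ->
  (A + 0 + F + B + D = 0)%E -> L <= 2 * E.
Proof.
case: A => [A| |] //; case: F => [F| |] //; case: B => [B| |] //;
  case: D => [D| |] //=; rewrite ?lee_fin//.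
move=> A0 LF /ler_normlP[B1 B2] /ler_normlP[D1 D2].
by move=> [AFBD]; lra.
Qed.

(** * The source term and the resulting inequality *)

Lemma source_integral_ge (R : realType) n (T lam eps : R) k (f : 'rV[R]_n -> R) :
  (0 < n)%N -> 4 * n%:R <= T -> 0 < lam -> 0 < eps ->
  measurable_fun setT f ->
  {ae lebesgue_rV R n, forall x, 0 <= f x} ->
  {ae lebesgue_rV R n, forall x, 1 <= enorm x -> eps * enorm x `^ (- lam) <= f x} ->
  ((eps * T `^ (- lam) * 4^-1 ^+ k.+3 * (T / (4 * n%:R)) ^+ n * (T / 4))%:E <=
   \int[@lebesgue_measure R]_(t in `]0%R, T[)
     \int[lebesgue_rV R n]_x (f x * testfun T T k t x)%:E)%E.
Proof.
move=> n0 T4n lam0 eps0 mf f0 fge.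
have nR : 1 <= n%:R :> R by rewrite ler1n.
have T0 : 0 < T by lra.
have T1 : 1 <= T by lra.
set c := eps * T `^ (- lam) * 4^-1 ^+ k.+3.
have c0 : 0 <= c.
  apply: mulr_ge0; last by rewrite exprn_ge0// invr_ge0.
  by apply: mulr_ge0; [exact: ltW|exact: powR_ge0].
set V := (T / (4 * n%:R)) ^+ n.
have V0 : 0 <= V by rewrite exprn_ge0// divr_ge0// ?ltW//; lra.
have cV0 : 0 <= c * V by exact: mulr_ge0.
have mtest t : measurable_fun [set: 'rV[R]_n] (testfun T T k t).
  by apply: measurable_funM; [exact: measurable_cst|exact: measurable_cutoff].
have fpsi0 t : {ae lebesgue_rV R n, forall x, 0 <= f x * testfun T T k t x}.
  by apply: filterS f0 => x f0; rewrite mulr_ge0// testfun_ge0.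
have boxV : lebesgue_rV R n (@box R n (T / (4 * n%:R)) (T / (2 * n%:R))) = V%:E.
  rewrite lebesgue_rV_box; last first.
    by rewrite ler_pM2l// lef_pV2 ?posrE; lra.
  by congr (_ ^+ _)%:E; field; lra.
pose J : set R := `[T / 8, 3 / 8 * T]%classic.
have JT : J `<=` `]0, T[%classic.
  by move=> t; rewrite /J/= !in_itv/= => /andP[t1 t2]; apply/andP; split; lra.
have mJ : measurable (J : set (measurableTypeR R)) by exact: measurable_itv.
apply: (@le_trans _ _ (\int[@lebesgue_measure R]_(t in `]0%R, T[)
    ((c * V)%:E * (\1_J t)%:E)))%E.
  rewrite ge0_integralZl//=; last first.
    by apply/measurable_EFinP; exact: measurable_indic.
  rewrite integral_indic//= setIidl//.
  rewrite [X in (_ * X)%E](_ : _ = (3 / 8 * T - T / 8)%:E); last first.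
    by apply: lebesgue_measure_itvcc; lra.
  by rewrite -EFinM lee_fin ler_wpM2l//; lra.
apply: ge0_le_integral_sup => t _.
  by rewrite -EFinM lee_fin mulr_ge0.
rewrite indicE; case: (boolP (t \in J)) => [/set_mem tJ|_]; last first.
  (* Off [J] only nonnegativity of the inner integral is wanted: this is [ge_measure_integral] with
     the empty set and constant 0. *)
  rewrite mule0 -(mul0e (lebesgue_rV R n set0)).
  apply: ge_measure_integral => //; first exact: measurable_funM.
  by apply: filterS f0.
rewrite mule1 EFinM -boxV; apply: ge_measure_integral => //.
- exact: measurable_box.
- exact: measurable_funM.
apply: filterS2 f0 fge => x f0 fge xb.
have /andP[x1 xT] := enorm_box n0 T4n xb.
apply: ler_pM; first by rewrite mulr_ge0 ?powR_ge0// ltW.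
- by rewrite exprn_ge0// invr_ge0.
- rewrite (le_trans _ (fge x1))// ler_pM2l// !powRN.
  have e0 : 0 < enorm x by lra.
  rewrite lef_pV2 ?posrE ?powR_gt0//.
  by apply: ge0_ler_powR; rewrite ?nnegrE; lra.
- by apply: testfun_ge => //; move: tJ; rewrite /J/= in_itv.
Qed.

Lemma weak_solution_le (R : realType) n m (p lam C1 : R) k
    (a : 'I_m -> 'I_n -> 'rV[R]_n -> R) (u0 : 'rV[R]_n -> R)
    (eps T : R) (f : 'rV[R]_n -> R) (u : R -> 'rV[R]_n -> R) :
  (0 < n)%N -> 1 < p -> 0 < lam -> 2 / (p - 1) <= k.+1%:R -> 0 < C1 ->
  (forall g x (N : R), Ck 2 g -> 0 <= N ->
    (forall s, (0 < size s <= 2)%N -> `|partials s g x| <= N) ->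
    `|laplacianX a g x| <= C1 * N) ->
  0 < eps -> L1loc f ->
  {ae lebesgue_rV R n, forall x, 0 <= f x} ->
  {ae lebesgue_rV R n, forall x, 1 <= enorm x -> eps * enorm x `^ (- lam) <= f x} ->
  4 * n%:R <= T -> weak_solution a p f u0 T u ->
  eps * T `^ (- lam) * 4^-1 ^+ k.+3 * (T / (4 * n%:R)) ^+ n * (T / 4) <=
  2 * (2^-1 * (2 * ((8 * k.+3%:R + C1 * (6 * k.+3%:R ^+ 2)) / T)) `^ (p / (p - 1)) *
    (2 * T) ^+ n * T).
Proof.
move=> n0 p1 lam0 kp C10 lapC eps0 [mf _] f0 fge T4n [[mu _] weak].
have nR : 1 <= n%:R :> R by rewrite ler1n.
have T0 : 0 < T by lra.
have T1 : 1 <= T by lra.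
have [kR kR0] : 1 <= k.+3%:R :> R /\ 0 <= 6 * k.+3%:R ^+ 2 :> R.
  by rewrite ler1n mulr_ge0.
have C60 : 0 <= C1 * (6 * k.+3%:R ^+ 2) by rewrite mulr_ge0// ltW.
(* The sum of the constants for the time derivative and for [laplacianX], so that one [K] serves
   both Young estimates. *)
set K := (8 * k.+3%:R + C1 * (6 * k.+3%:R ^+ 2)) / T.
have K0 : 0 < K by rewrite divr_gt0// ltr_wpDr// mulr_gt0.
set E := 2^-1 * _.
have E0 : 0 <= E by rewrite /E mulr_ge0// powR_ge0.
have := weak (testfun T T k) (testfun_test_function n k T0 T1)
  (fun t x _ => testfun_ge0 T T k t x).
rewrite [X in (_ + X + _ + _ + _)%E](_ : _ = 0%E); last first.
  rewrite (eq_integral (cst 0%E)) ?integral0// => x _.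
  by rewrite /testfun timecut0 mul0r mulr0.
have mh := @measurable_testfun_slab R n p T T k u mu.
have h0 (z : measurableTypeR R * 'rV[R]_n) :
    0 <= `|u z.1 z.2| `^ p * testfun T T k z.1 z.2.
  by apply: mulr_ge0; [exact: powR_ge0|exact: testfun_ge0].
apply: absorb_le.
- by apply: integral_ge0 => t _; apply: integral_ge0 => x _; rewrite lee_fin (h0 (t, x)).
- exact: source_integral_ge.
- apply: (slab_integral_le mh h0) => //; [exact: ltW|move=> t x _].
  apply: (young_testfun T1) => //.
  rewrite (le_trans (derive1_testfun_le _ _ T0 _ _))//.
  rewrite ler_wpM2r//; first by apply: mulr_ge0; [exact: timecut_ge0|exact: cutoff_ge0].
  by rewrite ler_pM2r ?invr_gt0// lerDl.
- apply: (slab_integral_le mh h0) => //; [exact: ltW|move=> t x _].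
  apply: (young_testfun T1) => //.
  have b0 : 0 <= timecut T k.+1 t * cutoff T k.+1 x.
    by apply: mulr_ge0; [exact: timecut_ge0|exact: cutoff_ge0].
  apply: (@le_trans _ _ (C1 * (6 * k.+3%:R ^+ 2 / T * (timecut T k.+1 t * cutoff T k.+1 x)))).
    apply: lapC; first exact: Ck2_cutoff.
      by rewrite mulr_ge0// divr_ge0// ltW.
    by move=> s s2; apply: partials_testfun_le.
  rewrite (_ : C1 * (6 * _ / T * _) = C1 * (6 * k.+3%:R ^+ 2) / T *
    (timecut T k.+1 t * cutoff T k.+1 x)); last by ring.
  rewrite ler_wpM2r// ler_pM2r ?invr_gt0// lerDr mulr_ge0//.
Qed.

(** * From the inequality to the lifespan *)

Lemma lifespan_of_le (R : realType) (G eps0 eps T b M : R) :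
  b < 0 -> 0 < G -> 0 < eps -> eps <= eps0 -> 0 <= M ->
  (M < T -> 0 < T /\ eps <= G * T `^ b^-1) ->
  T <= (G `^ (- b) + M * eps0 `^ (- b)) * eps `^ b.
Proof.
move=> b0 G0 e0 ee0 M0 MT.
have bn0 : b != 0 by rewrite lt_eqF.
have Nb0 : 0 <= - b by lra.
have eb : eps `^ b = (eps `^ (- b))^-1 by rewrite powRN invrK.
have eb0 : 0 < eps `^ (- b) by rewrite powR_gt0.
rewrite eb ler_pdivlMr//.
have [TM|/MT[T0 eG]] := leP T M.
  apply: (@le_trans _ _ (M * eps0 `^ (- b))).
    apply: (@le_trans _ _ (M * eps `^ (- b))); first by rewrite ler_pM2r.
    by rewrite ler_wpM2l// ge0_ler_powR ?nnegrE; lra.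
  by rewrite lerDr powR_ge0.
apply: (@le_trans _ _ (G `^ (- b))); last first.
  by rewrite lerDl mulr_ge0// powR_ge0.
rewrite mulrC -ler_pdivlMr//.
have -> : G `^ (- b) / T = (G * T `^ b^-1) `^ (- b).
  rewrite powRM ?ltW// ?powR_gt0// -powRrM mulrN mulVf// powR_inv1//.
  exact: ltW.
by rewrite ge0_ler_powR ?nnegrE ?mulr_ge0 ?powR_ge0// ltW.
Qed.

Theorem corollary3p3 (R : realType) (n m : nat) (p lam : R)
    (a : 'I_m -> 'I_n -> 'rV[R]_n -> R) (u0 : 'rV[R]_n -> R) :
  (2 < n)%N ->
  1 < p -> p < n%:R / (n%:R - 1) ->
  (forall k i, smooth (a k i)) ->
  (forall k i, [bounded a k i x | x in [set: 'rV[R]_n]]) ->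
  (forall k i j, [bounded partial i (a k j) x | x in [set: 'rV[R]_n]]) ->
  L1loc u0 ->
  0 < lam -> lam < p / (p - 1) ->
  forall eps0 : R, 0 < eps0 ->
  exists C : R, 0 < C /\
    forall (eps : R) (f : 'rV[R]_n -> R),
      0 < eps -> eps <= eps0 ->
      L1loc f ->
      {ae lebesgue_rV R n, forall x, 0 <= f x} ->
      {ae lebesgue_rV R n, forall x, 1 <= enorm x -> eps * enorm x `^ (- lam) <= f x} ->
      forall T : R, 0 < T ->
        (exists u : R -> 'rV[R]_n -> R, weak_solution a p f u0 T u) ->
        T <= C * eps `^ (2 / (lam - p / (p - 1))).
Proof.
move=> n2 p1 _ sa ba bda _ lam0 lamq eps0 eps00.
have n0 : (0 < n)%N by exact: leq_ltn_trans n2.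
have nR : 1 <= n%:R :> R by rewrite ler1n.
have [C1 C10 lapC] := laplacianX_le sa ba bda.
set q := p / (p - 1) in lamq *; set b := 2 / (lam - q).
have b0 : b < 0 by rewrite pmulr_rlt0// invr_lt0 subr_lt0.
pose k := Num.bound (2 / (p - 1)).
have kp : 2 / (p - 1) <= k.+1%:R.
  rewrite ltW// (lt_le_trans (archi_boundP _))// ?divr_ge0 ?ler_nat//.
  by rewrite subr_ge0 ltW.
pose D : R := 8 * k.+3%:R + C1 * (6 * k.+3%:R ^+ 2).
have D0 : 0 < D.
  by apply: addr_gt0; rewrite !mulr_gt0.
pose c0 : R := 4^-1 ^+ k.+3 * (4 * n%:R)^-1 ^+ n * 4^-1.
have c00 : 0 < c0.
  by do 2![apply: mulr_gt0 => //]; rewrite exprn_gt0 ?invr_gt0 ?mulr_gt0 ?ltr0n.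
(* [c0] collects the constants of the source bound, and [G] is the ratio of the constants of the two
   sides once [T ^+ n * T] is cancelled. *)
pose G := (2 * D) `^ q * 2 ^+ n / c0.
have G0 : 0 < G.
  apply: divr_gt0 => //; apply: mulr_gt0; last exact: exprn_gt0.
  by apply: powR_gt0; exact: mulr_gt0.
exists (G `^ (- b) + 4 * n%:R * eps0 `^ (- b)); split.
  by apply: addr_gt0; [exact: powR_gt0|rewrite !mulr_gt0 ?powR_gt0 ?ltr0n].
move=> eps f e0 ee0 Lf f0 fge T T0 [u wu].
(* Here [M] is [4 * n%:R], the threshold from which the cube used for the source lies outside the
   unit ball. *)
apply: lifespan_of_le => // /ltW T4n; split=> //.
have T1 : 1 <= T by lra.
have := weak_solution_le n0 p1 lam0 kp C10 lapC e0 Lf f0 fge T4n wu.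
rewrite -/D -/q => key.
have qE : (2 * (D / T)) `^ q = (2 * D) `^ q * T `^ (- q).
  rewrite mulrA powRM ?mulr_ge0 ?invr_ge0 ?(ltW T0) ?(ltW D0)//; congr (_ * _).
  by rewrite powRN -powR_inv1 ?(ltW T0)// -powRrM mulN1r powRN.
have key2 : eps * c0 * T `^ (- lam) <= (2 * D) `^ q * 2 ^+ n * T `^ (- q).
  have TS0 : 0 < T ^+ n * T by rewrite mulr_gt0 ?exprn_gt0.
  rewrite -(ler_pM2r TS0); move: key; rewrite qE /c0 !exprMn.
  congr (_ <= _).
    by move: (_ ^+ k.+3) ((4 * n%:R)^-1 ^+ n) => x y; ring.
  by field.
have key3 : eps <= G * T `^ (lam - q).
  rewrite powRD ?(gt_eqF T0) ?implybT// /G mulrAC ler_pdivlMr//.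
  rewrite -(ler_pM2r (_ : 0 < T `^ (- lam))) ?powR_gt0//.
  rewrite (le_trans key2)// !mulrA [leRHS](_ : _ = (2 * D) `^ q * 2 ^+ n *
    T `^ (- q) * (T `^ lam * T `^ (- lam))); last by ring.
  by rewrite -powRD ?(gt_eqF T0) ?implybT// subrr powRr0 mulr1.
(* Since [b^-1 = (lam - q) / 2] with [lam - q < 0] and [T >= 1], halving the exponent only enlarges
   the power of [T]. *)
rewrite (le_trans key3)// ler_pM2l// ler_powR// /b invf_div.
lra.
Qed.
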